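(* Let $\Omega\subseteq\mathbb{R}^n$ be an open set. For a net $(u_\varepsilon)$ of functions in $\mathcal{C}^\infty(\Omega,\mathbb{R})$, indexed by $\varepsilon\in(0,1]$ in (i), (ii) and by $\varepsilon\in\hat I=\mathcal{D}(\mathbb{R}^d)$ in (iii), (iv): (i) $(u_\varepsilon)\in\mathcal{E}^{\mathrm{s}}_M(\Omega)$ if and only if $\forall K\Subset\Omega\ \forall\alpha\in\mathbb{N}^n\ \exists N\in\mathbb{N}:\ \sup_{x\in K}|\partial^\alpha u_\varepsilon(x)|=O(\varepsilon^{-N})$ as $\varepsilon\in\mathbb{I}^{\mathrm{s}}$; (ii) $(u_\varepsilon)\in\mathcal{N}^{\mathrm{s}}(\Omega)$ if and only if $\forall K\Subset\Omega\ \forall\alpha\in\mathbb{N}^n\ \forall m\in\mathbb{N}:\ \sup_{x\in K}|\partial^\alpha u_\varepsilon(x)|=O(\varepsilon^{m})$ as $\varepsilon\in\mathbb{I}^{\mathrm{s}}$; (iii) $(u_\varepsilon)\in\mathcal{M}(\mathcal{E}(\Omega)^{\mathcal{D}_0})$ if and only if $\forall K\Subset\Omega\ \forall\alpha\in\mathbb{N}^n\ \exists N\in\mathbb{N}:\ \sup_{x\in K}|\partial^\alpha u_\varepsilon(x)|=O(\underline{\varepsilon}^{-N})$ as $\varepsilon\in\hat{\mathbb{I}}$; (iv) $(u_\varepsilon)\in\mathcal{N}(\mathcal{E}(\Omega)^{\mathcal{D}_0})$ if and only if $\forall K\Subset\Omega\ \forall\alpha\in\mathbb{N}^n\ \forall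 m\in\mathbb{N}:\ \sup_{x\in K}|\partial^\alpha u_\varepsilon(x)|=O(\underline{\varepsilon}^{m})$ as $\varepsilon\in\hat{\mathbb{I}}$.
   Context: $\mathbb{N}=\{0,1,2,\dots\}$; $K\Subset\Omega$ means that $K$ is a compact subset of $\Omega$. Big-O. For a triple $\mathbb{I}=(I,\le,\mathcal{I})$ ($\le$ a pre-order on $I$, $\mathcal{I}$ a set of nonempty subsets of $I$), put $(\emptyset,e]:=\{\varepsilon\in I\mid\varepsilon\le e\}$ and $A_{\le e}:=(\emptyset,e]\cap A$. For real nets $(x_\varepsilon),(y_\varepsilon)\in\mathbb{R}^I$, ''$x_\varepsilon=O(y_\varepsilon)$ as $\varepsilon\in\mathbb{I}$'' means: there is $A\in\mathcal{I}$ such that for all $a\in A$ there are $H>0$ and $\varepsilon_0\in A_{\le a}$ with $|x_\varepsilon|\le H|y_\varepsilon|$ for all $\varepsilon\in A_{\le\varepsilon_0}$. The triple $\mathbb{I}^{\mathrm{s}}=(I^{\mathrm{s}},\le,\mathcal{I}^{\mathrm{s}})$: $I^{\mathrm{s}}=(0,1]$ with the usual order, $\mathcal{I}^{\mathrm{s}}=\{(0,\varepsilon_0]\mid\varepsilon_0\in(0,1]\}$. The triple $\hat{\mathbb{I}}=(\hat I,\le,\hat{\mathcal{I}})$: $\hat I=\mathcal{D}_0=\mathcal{D}(\mathbb{R}^d)$ ($d\ge1$) is the space of smooth compactly supported functions on $\mathbb{R}^d$; $\underline{\varphi}:=\mathrm{diam}(\mathrm{supp}(\varphi))$ if $\varphi\ne0$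 and $\underline{0}:=1$; $\varphi\le\psi$ iff $\underline\varphi\le\underline\psi$; and $\hat{\mathcal{I}}$ is a fixed free ultrafilter on $\mathcal{D}_0$ for which there are sets $\mathcal{D}_n\in\hat{\mathcal{I}}$ ($n\ge1$) with $\underline\varphi\le\frac1n$ for all $\varphi\in\mathcal{D}_n$. A property $\mathcal{P}(\varphi)$ holds almost everywhere (a.e.) if $\{\varphi\in\mathcal{D}_0\mid\mathcal{P}(\varphi)\}\in\hat{\mathcal{I}}$. Moderate and negligible nets. For nets indexed by $(0,1]$: $(u_\varepsilon)\in\mathcal{E}_M^{\mathrm{s}}(\Omega)$ iff $\forall K\Subset\Omega\,\forall\alpha\in\mathbb{N}^n\,\exists N\in\mathbb{N}$: $\sup_{x\in K}|\partial^\alpha u_\varepsilon(x)|=O(\varepsilon^{-N})$ as $\varepsilon\to0^+$ (usual Landau symbol); $(u_\varepsilon)\in\mathcal{N}^{\mathrm{s}}(\Omega)$ iff $\forall K\Subset\Omega\,\forall\alpha\in\mathbb{N}^n\,\forall m\in\mathbb{N}$: $\sup_{x\in K}|\partial^\alpha u_\varepsilon(x)|=O(\varepsilon^{m})$ as $\varepsilon\to0^+$. For nets indexed by $\mathcal{D}_0$: $(u_\varphi)\in\mathcal{M}(\mathcal{E}(\Omega)^{\mathcal{D}_0})$ iff $\forall K\Subset\Omega\,\forall\alpha\in\mathbb{N}^n\,\exists N\in\mathbb{N}\,\exists H>0$: $\sup_{x\in K}|\partial^\alpha u_\varphi(x)|\le H\underline{\varphi}^{-N}$ a.e.; $(u_\varphi)\in\mathcal{N}(\mathcal{E}(\Omega)^{\mathcal{D}_0})$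 iff $\forall K\Subset\Omega\,\forall\alpha\in\mathbb{N}^n\,\forall m\in\mathbb{N}\,\exists H>0$: $\sup_{x\in K}|\partial^\alpha u_\varphi(x)|\le H\underline{\varphi}^{m}$ a.e. *)

(* Defs.v *)
From HB Require Import structures.
From mathcomp Require Import all_boot all_order all_algebra.
From mathcomp Require Import all_classical all_reals all_analysis.
Set Implicit Arguments.
Unset Strict Implicit.
Unset Printing Implicit Defensive.
Import Order.TTheory GRing.Theory Num.Theory.
Import numFieldNormedType.Exports.
Local Open Scope classical_set_scope.
Local Open Scope ring_scope.

(* R^n is 'rV[R]_n. Its library norm is the sup norm, used here only for the
   topology; diameters are taken with respect to the Euclidean distance. *)
Section smooth_functions.
Context {R : realType} {n : nat}.
Implicit Types (Omega K : set 'rV[R]_n) (f : 'rV[R]_n -> R).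

Definition partial (i : 'I_n) f : 'rV[R]_n -> R := 'D_(delta_mx 0 i) f.

Definition partials (s : seq 'I_n) f : 'rV[R]_n -> R := foldr partial f s.

(* alpha ranges over N^n; the derivatives are taken in a fixed order, which is
   irrelevant on smooth functions *)
Definition partial_multi (alpha : {ffun 'I_n -> nat}) f : 'rV[R]_n -> R :=
  foldr (fun i g => iter (alpha i) (partial i) g) f (enum 'I_n).

(* For Omega open this only depends on the restriction of f to Omega. *)
Definition smooth_on Omega f : Prop :=
  forall (s : seq 'I_n) (x : 'rV[R]_n), Omega x ->
    {for x, continuous (partials s f)} /\
    forall i : 'I_n, derivable (partials s f) x (delta_mx 0 i).

(* An element of C^oo(Omega, R) is represented by a total function, whose
   values outside of Omega are irrelevant. *)
Record smooth_fun Omega := SmoothFun {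
  smooth_val :> 'rV[R]_n -> R ;
  smooth_valP : smooth_on Omega smooth_val }.

Definition compact_in K Omega : Prop := compact K /\ K `<=` Omega.

(* For f smooth around K compact, the set is bounded; for K empty the
   supremum is 0. *)
Definition sup_partial K (alpha : {ffun 'I_n -> nat}) f : R :=
  sup [set `|partial_multi alpha f x| | x in K].

Definition supp f : set 'rV[R]_n := closure [set x | f x != 0].

Definition edist (x y : 'rV[R]_n) : R :=
  Num.sqrt (\sum_(i < n) (x 0 i - y 0 i) ^+ 2).

Definition diam (A : set 'rV[R]_n) : R :=
  sup [set edist p.1 p.2 | p in A `*` A].

End smooth_functions.

(* the triples (I, <=, calI) along which big-O is taken *)
Record index_triple := IndexTriple {
  idx :> Type ;
  idx_le : rel idx ;
  idx_sets : set_system idx ;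
  idx_le_refl : reflexive idx_le ;
  idx_le_trans : transitive idx_le ;
  idx_sets_nonempty : forall A, idx_sets A -> A !=set0 }.

Definition below (I : index_triple) (e : I) : set I :=
  [set e' | idx_le e' e].

Definition triple_bigO {R : realType} (I : index_triple) (x y : I -> R) :
    Prop :=
  exists2 A : set I, idx_sets A &
    forall a, A a -> exists H : R, exists e0 : I,
      [/\ 0 < H, (below a `&` A) e0 &
          forall e, (below e0 `&` A) e -> `|x e| <= H * `|y e|].

Section small_parameter.
Context {R : realType}.

Definition Is : Type := {e : R | 0 < e <= 1}.

Definition Is_le : rel Is := fun e e' => sval e <= sval e'.

Definition Is_sets : set_system Is :=
  [set [set e | Is_le e e0] | e0 in [set: Is]].

Lemma Is_le_refl : reflexive Is_le.
Proof. by move=> e; rewrite /Is_le. Qed.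

Lemma Is_le_trans : transitive Is_le.
Proof. by move=> e e' e''; exact: le_trans. Qed.

Lemma Is_sets_nonempty (A : set Is) : Is_sets A -> A !=set0.
Proof. by case=> e0 _ <-; exists e0; exact: Is_le_refl. Qed.

Definition Is_triple : index_triple :=
  IndexTriple Is_le_refl Is_le_trans Is_sets_nonempty.

(* the filter of the limit e -> 0^+ on the index set (0, 1] *)
Definition Is_zero : set_system Is :=
  fun P => \forall t \near (0 : R)^'+, forall e : Is, sval e = t -> P e.

Global Instance Is_zero_filter : Filter Is_zero.
Proof.
split.
- exact: nearW.
- move=> P Q; apply: (@filterS2 _ (0 : R)^'+) => t Pt Qt e et; split; [exact: Pt|exact: Qt].
- move=> P Q PQ; apply: (@filterS _ (0 : R)^'+) => t Pt e et; exact/PQ/Pt.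
Qed.

Canonical Is_zero_filter_on := FilterType Is_zero Is_zero_filter.

End small_parameter.
Arguments Is R : clear implicits.
Arguments Is_triple R : clear implicits.

Section test_functions.
Context {R : realType} {d : nat}.

Record test_fun := TestFun {
  test_val :> 'rV[R]_d -> R ;
  test_smooth : smooth_on setT test_val ;
  test_compact : compact (supp test_val) }.

(* \underline{phi}, with \underline{0} = 1 by convention *)
Definition und (phi : test_fun) : R :=
  if `[< forall x, phi x = 0 >] then 1 else diam (supp phi).

Definition test_le : rel test_fun := fun phi psi => und phi <= und psi.

Lemma test_le_refl : reflexive test_le.
Proof. by move=> phi; rewrite /test_le. Qed.

Lemma test_le_trans : transitive test_le.
Proof. by move=> phi psi chi; exact: le_trans. Qed.

Record shrinking_free_ultrafilter (U : set_system test_fun) : Prop :=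
  ShrinkingFreeUltrafilter {
    sfu_ultra : UltraFilter U ;
    sfu_free : \bigcap_(A in U) A = set0 ;
    sfu_shrink : exists D : nat -> set test_fun,
      forall k, (1 <= k)%N -> U (D k) /\
        forall phi, D k phi -> und phi <= k%:R^-1 }.

Lemma sfu_nonempty U : shrinking_free_ultrafilter U ->
  forall A, U A -> A !=set0.
Proof. by case=> HU _ _ A; exact: filter_ex. Qed.

Definition test_triple U (hU : shrinking_free_ultrafilter U) : index_triple :=
  IndexTriple test_le_refl test_le_trans (sfu_nonempty hU).

End test_functions.
Arguments test_fun R d : clear implicits.

Section moderate_negligible.
Context {R : realType} {n : nat} (Omega : set 'rV[R]_n).

Definition moderate_s (u : Is R -> smooth_fun Omega) : Prop :=
  forall K, compact_in K Omega -> forall alpha, exists N : nat,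
    (fun e => sup_partial K alpha (u e) : R^o)
      =O_ Is_zero (fun e => sval e ^- N : R^o).

Definition negligible_s (u : Is R -> smooth_fun Omega) : Prop :=
  forall K, compact_in K Omega -> forall alpha, forall m : nat,
    (fun e => sup_partial K alpha (u e) : R^o)
      =O_ Is_zero (fun e => sval e ^+ m : R^o).

Context {d : nat} (U : set_system (test_fun R d)).

(* P holds almost everywhere when U [set phi | P phi] *)
Definition moderate_test (u : test_fun R d -> smooth_fun Omega) : Prop :=
  forall K, compact_in K Omega -> forall alpha,
    exists N : nat, exists2 H : R, 0 < H &
      U [set phi | sup_partial K alpha (u phi) <= H * und phi ^- N].

Definition negligible_test (u : test_fun R d -> smooth_fun Omega) : Prop :=
  forall K, compact_in K Omega -> forall alpha, forall m : nat,
    exists2 H : R, 0 < H &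
      U [set phi | sup_partial K alpha (u phi) <= H * und phi ^+ m].

End moderate_negligible.

(* Main.v *)
Require Import Defs.
From HB Require Import structures.
From mathcomp Require Import all_boot all_order all_algebra.
From mathcomp Require Import all_classical all_reals all_analysis.
Set Implicit Arguments.
Unset Strict Implicit.
Unset Printing Implicit Defensive.
Import Order.TTheory GRing.Theory Num.Theory.
Import numFieldNormedType.Exports.
Local Open Scope classical_set_scope.
Local Open Scope ring_scope.

(* On (0, 1] the set in the big-O of the triple is an interval (0, e1], so
   testing at its endpoint gives the Landau estimate; conversely the estimate
   near 0 holds below min(a, r / 2) for every a. On the test functions, an
   estimate holding on a set A of the ultrafilter holds below each a in A.
   Conversely, an estimate on A below e0 holds a.e. because
   D_k `<=` (below e0) as soon as 1 / k <= \underline{e0}; such a k exists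
   because \underline{e0} > 0: a nonzero continuous function is nonzero at two
   distinct points, and this is where d >= 1 is used. *)

(** An empty or unbounded [S] has the default supremum 0; otherwise any element of [S] is a
    nonnegative lower bound for the supremum. *)
Lemma sup_ge0 (R : realType) (S : set R) :
  (forall x, S x -> 0 <= x) -> 0 <= sup S.
Proof.
move=> S0; have [[[x Sx] uS]|/sup_out -> //] := pselect (has_sup S).
exact: le_trans (S0 x Sx) (ub_le_sup uS Sx).
Qed.

Lemma sup_partial_ge0 (R : realType) (n : nat) (K : set 'rV[R]_n)
    (alpha : {ffun 'I_n -> nat}) (f : 'rV[R]_n -> R) :
  0 <= sup_partial K alpha f.
Proof. by apply: sup_ge0 => _ [x _ <-]. Qed.

(* The qualified Defs.edist is the Euclidean distance; the bare name is
   shadowed by the extended distance of MathComp-Analysis. *)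
Section und_positive.
Context {R : realType} {d : nat}.
Implicit Types (A : set 'rV[R]_d) (x y : 'rV[R]_d).

Lemma edist_gt0 x y (i : 'I_d) : x 0 i != y 0 i -> 0 < Defs.edist x y.
Proof.
move=> xy; rewrite /Defs.edist sqrtr_gt0 (bigD1 i)//= ltr_pwDl//.
  by rewrite exprn_even_gt0//= subr_eq0.
by apply: sumr_ge0 => j _; exact: sqr_ge0.
Qed.

(** Compactness bounds the set of distances, so that [diam A] is a true supremum and not the default
    0. *)
Lemma edist_le_diam A x y : compact A -> A x -> A y -> Defs.edist x y <= diam A.
Proof.
move=> /compact_bounded[M0 [_ /(_ (M0 + 1))]]; rewrite ltrDl ltr01 => /(_ isT).
set M := M0 + 1 => AM Ax Ay.
apply: ub_le_sup; last by exists (x, y).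
(* The sup norm is at most [M] on [A], so two points of [A] differ by at most [M + M] in each
   coordinate. *)
exists (Num.sqrt (\sum_(i < d) (M + M) ^+ 2)) => _ [[a b] [/= Aa Ab] <-].
have coord z i : A z -> `|z 0 i| <= M.
  move=> /AM /=; apply: le_trans.
  by rewrite [leRHS]/Num.norm /= mx_normrE; apply: (le_bigmax _ _ (0, i)).
apply: ler_wsqrtr; apply: ler_sum => i _; rewrite -real_normK ?num_real//.
rewrite lerXn2r ?nnegrE//.
  by rewrite addr_ge0// (le_trans _ (coord _ i Aa)).
by rewrite (le_trans (ler_normB _ _))// lerD// coord.
Qed.

Lemma und_gt0 (phi : test_fun R d) : (1 <= d)%N -> 0 < und phi.
Proof.
move=> d0; rewrite /und; case: asboolP => // /existsNP[x /eqP phix].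
have /nbhs_ballP[e /= e0 xe] : \forall y \near x, phi y != 0.
  have [phic _] := @test_smooth _ _ phi [::] x I.
  exact: (cvgr_neq0 _ phic phix).
pose i : 'I_d := Ordinal d0.
(* Moving by [e / 2] along one axis stays in the ball of radius [e] around [x], where [phi] does not
   vanish. *)
pose y := x + (e / 2) *: delta_mx 0 i.
have e2 : 0 < e / 2 by rewrite divr_gt0.
have phiy : phi y != 0.
  apply: xe; split=> // j k; rewrite /ball /= /ball_ /= !mxE opprD addNKr normrN.
  rewrite normrM gtr0_norm//; case: eqP => _; case: eqP => _ /=;
    rewrite ?normr0 ?normr1 ?mulr0 ?mulr1//.
  by rewrite ltr_pdivrMr// ltr_pMr// ltr1n.
apply: (@lt_le_trans _ _ (Defs.edist x y)).
  apply: (@edist_gt0 _ _ i).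
  by rewrite !mxE !eqxx mulr1 -subr_eq0 opprD addNKr oppr_eq0 gt_eqF.
by apply: edist_le_diam; [exact: test_compact|exact: subset_closure..].
Qed.

End und_positive.

Lemma bigO_zeroP (R : realType) (x y : Is R -> R) :
  (x : Is R -> R^o) =O_ Is_zero (y : Is R -> R^o) <->
  triple_bigO (I := Is_triple R) x y.
Proof.
split=> [/eqO_exP[H H0 [/= r /= r0 xy]]|[_ [e1 _ <-] /(_ e1)]].
  (* With endpoint 1 the interval is the whole index set. *)
  pose e1 : Is R := exist (fun e : R => 0 < e <= 1) 1 (introT andP (conj ltr01 (lexx 1))).
  exists [set e | Is_le e e1]; first by exists e1.
  move=> a _; have /andP[a0 a1] := svalP a.
  (* The Landau estimate holds strictly below [r], whence the half; the minimum with [a] puts the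
     witness below [a]. *)
  have e0P : 0 < Num.min (sval a) (r / 2) <= 1.
    by rewrite lt_min a0 divr_gt0//= ge_min a1.
  exists H, (exist (fun e : R => 0 < e <= 1) _ e0P); split => //.
    by split; rewrite /below /= /Is_le /= ge_min ?lexx ?a1.
  move=> e [+ _]; rewrite /below /= /Is_le /= le_min => /andP[_ er].
  have /andP[e_gt0 _] := svalP e; apply: (xy (sval e)) => //=.
  rewrite sub0r normrN gtr0_norm// (le_lt_trans er)//.
  by rewrite ltr_pdivrMr// ltr_pMr// ltr1n.
case; first exact: Is_le_refl.
move=> H [e0 [H0 [_ e01] xy]]; apply/eqO_exP; exists H => //.
have /andP[e0_gt0 _] := svalP e0; exists (sval e0) => //= t.
rewrite /= sub0r normrN => te0 t0 e et; apply: xy.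
have ee0 : Is_le e e0 by rewrite /Is_le et ltW// -(gtr0_norm t0).
by split => //=; exact: Is_le_trans ee0 e01.
Qed.

(** The a.e. estimate has no absolute values while the big-O has them; nonnegativity of [x] and [y]
    reconciles the two. *)
Lemma bigO_testP (R : realType) (d : nat) (hd : (1 <= d)%N)
    (U : set_system (test_fun R d)) (hU : shrinking_free_ultrafilter U)
    (x y : test_fun R d -> R) :
  (forall phi, 0 <= x phi) -> (forall phi, 0 <= y phi) ->
  (exists2 H : R, 0 < H & U [set phi | x phi <= H * y phi]) <->
  triple_bigO (I := test_triple hU) x y.
Proof.
move=> x0 y0; have [UU _ [D HD]] := hU.
split=> [[H H0 UH]|[A UA]].
  (* The set where the estimate holds serves as [A]; there each [a] is its own [e0], with the same
     [H]. *)
  exists [set phi | x phi <= H * y phi] => // a Ha; exists H, a; split => //.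
    by split=> //; exact: test_le_refl.
  by move=> e [_ xy]; rewrite !ger0_norm.
have [a Aa] := filter_ex UA.
move=> /(_ a Aa)[H [e0 [H0 _ xy]]]; exists H => //.
(* The successor makes [k] exceed [(und e0)^-1], so every element of [D k] lies below [e0]. *)
pose k := (Num.truncn (und e0)^-1).+1.
have [UDk Dk] := HD k isT.
apply: filterS (filterI UA UDk) => phi [Aphi /Dk phik].
rewrite /= -(ger0_norm (x0 phi)) -(ger0_norm (y0 phi)); apply: xy; split => //.
rewrite /below /= /test_le (le_trans phik)// invf_ple ?posrE ?und_gt0//.
by rewrite ltW// truncnS_gt.
Qed.

Theorem corollary17 (R : realType) (n d : nat) (hd : (1 <= d)%N)
    (Omega : set 'rV[R]_n) (oOmega : open Omega)
    (U : set_system (test_fun R d)) (hU : shrinking_free_ultrafilter U) :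
  (forall u : Is R -> smooth_fun Omega,
    moderate_s u <->
    forall K, compact_in K Omega -> forall alpha : {ffun 'I_n -> nat},
      exists N : nat,
      triple_bigO (I := Is_triple R)
        (fun e => sup_partial K alpha (u e)) (fun e => sval e ^- N)) /\
  (forall u : Is R -> smooth_fun Omega,
    negligible_s u <->
    forall K, compact_in K Omega -> forall alpha : {ffun 'I_n -> nat},
      forall m : nat,
      triple_bigO (I := Is_triple R)
        (fun e => sup_partial K alpha (u e)) (fun e => sval e ^+ m)) /\
  (forall u : test_fun R d -> smooth_fun Omega,
    moderate_test U u <->
    forall K, compact_in K Omega -> forall alpha : {ffun 'I_n -> nat},
      exists N : nat,
      triple_bigO (I := test_triple hU)
        (fun phi => sup_partial K alpha (u phi)) (fun phi => und phi ^- N)) /\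
  (forall u : test_fun R d -> smooth_fun Omega,
    negligible_test U u <->
    forall K, compact_in K Omega -> forall alpha : {ffun 'I_n -> nat},
      forall m : nat,
      triple_bigO (I := test_triple hU)
        (fun phi => sup_partial K alpha (u phi)) (fun phi => und phi ^+ m)).
Proof.
split; [|split; [|split]] => u.
- split=> Hu K KO alpha; have [N HN] := Hu K KO alpha; exists N; exact/bigO_zeroP.
- by split=> Hu K KO alpha m; apply/bigO_zeroP; exact: Hu.
(* Positivity of [und phi] makes the weights nonnegative, as [bigO_testP] requires. *)
- have undN N phi : 0 <= @und R d phi ^- N.
    by rewrite invr_ge0 exprn_ge0// ltW// und_gt0.
  split=> Hu K KO alpha; have [N HN] := Hu K KO alpha; exists N.
    by apply/bigO_testP => // phi; exact: sup_partial_ge0.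
  by apply/(bigO_testP hd hU) => // phi; exact: sup_partial_ge0.
- have undX m phi : 0 <= @und R d phi ^+ m by rewrite exprn_ge0// ltW// und_gt0.
  split=> Hu K KO alpha m.
    by apply/bigO_testP => // [phi|]; [exact: sup_partial_ge0|exact: Hu].
  by apply/(bigO_testP hd hU) => // [phi|]; [exact: sup_partial_ge0|exact: Hu].
Qed.
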